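(* Let $n\ge 1$ and let $x$ be an indeterminate. Let $\mathscr{M}$ be the $n\times n$ matrix with entries $\mathscr{M}[i,j]=\mathscr{C}_{i+j-2}+x\,\mathscr{C}_{i+j-1}$ for $1\le i,j\le n$, where $\mathscr{C}_m=\frac{1}{m+1}\binom{2m}{m}$ is the $m$-th Catalan number. For integers $k,i\ge 1$ define \[ F(k,i)=\frac{1}{i(2i-1)}\binom{2i}{i-k}\sum_{0\le r\le k}\frac{1}{2k-r}\binom{2k-r}{r}\Big(ri+2ik^2-ik-2rk^2+2k^3-k^2\Big)x^r, \] and for integers $k\ge 0$ define \[ g(k)=\sum_{0\le r\le k}\binom{2k-r}{r}x^r . \] Then $F(k,k)=g(k)$ for $k\ge1$, and, defining the $n\times n$ matrices $L$ and $U$ (with entries rational functions of $x$) by \[ L[i,k]=\frac{F(k,i)}{g(k)},\qquad U[k,j]=\frac{F(k,j)}{g(k-1)}\qquad(1\le i,j,k\le n), \] $L$ is lower triangular with all diagonal entries equal to $1$, $U$ is upper triangular, and $LU=\mathscr{M}$; that is, $(L,U)$ is the LU-decomposition of $\mathscr{M}$.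
   Context: Binomial coefficients $\binom{a}{b}$ with integers $a\ge0$ and $b<0$ are taken to be $0$ (so $F(k,i)=0$ whenever $k>i$). The identity $LU=\mathscr{M}$ is an identity of rational functions in $x$ (equivalently, it holds for every value of $x$ at which all $g(k)$, $0\le k\le n$, are nonzero). *)

(* Defs.v *)
From mathcomp Require Import all_boot all_order all_algebra.

Set Implicit Arguments.
Unset Strict Implicit.
Unset Printing Implicit Defensive.

Import GRing.Theory.

Local Open Scope ring_scope.

(* The indeterminate x, as an element of the field Q(x) *)
Definition indet : {fraction {poly rat}} := tofrac 'X.

(* The lower index ranges over the integers so that the binomial vanishes when
   it is negative; truncated subtraction would give 'C(2 * i, i - k) = 1 for
   k > i. *)
Definition binz (a : nat) (b : int) : nat :=
  if b is Posz m then 'C(a, m) else 0%N.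

Section Entries.

Variables (K : fieldType) (x : K).

Definition catalan (m : nat) : K := 'C(2 * m, m)%:R / m.+1%:R.

(* The natural-number subtraction 2 * k - r is never truncated, as r <= k. *)
Definition g (k : nat) : K :=
  \sum_(0 <= r < k.+1) 'C(2 * k - r, r)%:R * x ^+ r.

Definition Fcoef (k i r : nat) : K :=
  let k' : K := k%:R in let i' : K := i%:R in let r' : K := r%:R in
  r' * i' + 2 * i' * k' ^+ 2 - i' * k' - 2 * r' * k' ^+ 2 + 2 * k' ^+ 3
  - k' ^+ 2.

(* Meaningful for k, i >= 1 only: otherwise a denominator vanishes. *)
Definition F (k i : nat) : K :=
  (i%:R * (2 * i%:R - 1))^-1 * (binz (2 * i) (i%:Z - k%:Z))%:R
  * \sum_(0 <= r < k.+1)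
      (2 * k%:R - r%:R)^-1 * 'C(2 * k - r, r)%:R * Fcoef k i r * x ^+ r.

(* An index i : 'I_n stands for the row or column number i.+1. *)
Definition catalan_mx (n : nat) : 'M[K]_n :=
  \matrix_(i < n, j < n)
    (catalan (i.+1 + j.+1 - 2) + x * catalan (i.+1 + j.+1 - 1)).

Definition L_mx (n : nat) : 'M[K]_n :=
  \matrix_(i < n, k < n) (F k.+1 i.+1 / g k.+1).

Definition U_mx (n : nat) : 'M[K]_n :=
  \matrix_(k < n, j < n) (F k.+1 j.+1 / g (k.+1 - 1)).

End Entries.

(* Main.v *)
Require Import Defs.
From mathcomp Require Import all_boot all_order all_algebra.
From mathcomp Require Import ring zify.
Local Open Scope ring_scope.

(** Let B be the lower unitriangular matrix of ballot numbers, so that B B^T is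
    the Hankel matrix of the Catalan numbers, and shifting the rows of B by one
    is multiplication by the tridiagonal matrix T with diagonal 1, 2, 2, ...
    and off-diagonal entries 1. The matrix to be factored is B (1 + x T) B^T.
    The leading principal minors of 1 + x T satisfy the recurrence of g, so
    1 + x T = D' E D'^T with E = diag(g(k) / g(k-1)) and D' lower bidiagonal,
    and the entries of B D' are the F(k,i) / g(k) because
    F(k,i) = B[i,k] g(k) + x B[i,k+1] g(k-1), termwise in x. *)

Import GRing.Theory.

Section LUDecomposition.

Variables (K : fieldType) (x : K).

Lemma natr_bin_diag (n m : nat) :
  n.+1%:R * 'C(n, m)%:R = m.+1%:R * 'C(n.+1, m.+1)%:R :> K.
Proof. by rewrite -!natrM mul_bin_diag. Qed.

Lemma natr_bin_down (n m : nat) :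
  n.+1%:R * 'C(n, m)%:R = (n.+1%:R - m%:R) * 'C(n.+1, m)%:R :> K.
Proof.
have [le_mn|lt_nm] := leqP m n.+1; last first.
  by rewrite !bin_small ?mulr0 //; apply: ltnW.
by rewrite -natrB // -!natrM (mul_bin_down n.+1 m).
Qed.

(** Terms with [2r > n] vanish. These Fibonacci-like polynomials give [g] at even indices, so the
    recurrence of [g] is a bisection of the simpler one below. *)
Definition fibpoly (n : nat) : K :=
  \sum_(0 <= r < n.+1) 'C(n - r, r)%:R * x ^+ r.

Lemma fibpolyS (n : nat) : fibpoly n.+2 = fibpoly n.+1 + x * fibpoly n.
Proof.
rewrite /fibpoly big_nat_recr //= subnn bin0n mul0r addr0.
rewrite big_nat_recl // [in RHS]big_nat_recl // !subn0 !bin0 -addrA.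
congr (_ + _); rewrite mulr_sumr -big_split /=.
apply: eq_big_nat => r /andP[_ le_rn].
rewrite !subSS subSn // binS natrD exprS; ring.
Qed.

Lemma g_fibpoly (k : nat) : g x k = fibpoly (2 * k).
Proof.
rewrite /g /fibpoly [RHS](big_cat_nat (n := k.+1)) //=; last by lia.
rewrite [X in _ = _ + X]big_nat [X in _ = _ + X]big1 ?addr0 // => r /andP[lt_kr _].
by rewrite bin_small ?mul0r //; lia.
Qed.

Lemma g0 : g x 0 = 1.
Proof. by rewrite /g big_nat1 bin0 mul1r. Qed.

Lemma g1 : g x 1 = 1 + x.
Proof. by rewrite /g big_nat_recr //= big_nat1 !bin0 bin1 !mul1r. Qed.

Lemma g_rec (k : nat) : g x k.+2 = (1 + 2 * x) * g x k.+1 - x ^+ 2 * g x k.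
Proof.
rewrite !g_fibpoly !mulnS !add2n !fibpolyS; ring.
Qed.

(* Written with [i + k] rather than [i - k], which would truncate. *)
Definition ballot (i k : nat) : K :=
  'C(2 * i, i + k)%:R - 'C(2 * i, (i + k).+1)%:R.

Lemma ballot_small (i k : nat) : (i < k)%N -> ballot i k = 0.
Proof. by move=> lt_ik; rewrite /ballot !bin_small ?subrr //; lia. Qed.

Lemma ballot_diag (i : nat) : ballot i i = 1.
Proof.
by rewrite /ballot addnn -mul2n binn bin_small ?subr0.
Qed.

Lemma ballot_recS (i k : nat) :
  ballot i.+1 k.+1 = ballot i k + 2 * ballot i k.+1 + ballot i k.+2.
Proof.
rewrite /ballot mulnS add2n !addSn !addnS !binS !natrD; ring.
Qed.

(** By symmetry of binomials the missing neighbour would be B[i,-1] = -B[i,0]; this lowers the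
    coefficient 2 to 1, the corner entry of T. *)
Lemma ballot_rec0 (i : nat) : ballot i.+1 0 = ballot i 0 + ballot i 1.
Proof.
have central : 'C(2 * i.+1, i.+1) = (2 * ('C(2 * i, i.+1) + 'C(2 * i, i)))%N.
  rewrite mulnS add2n [LHS]binS.
  have -> : 'C((2 * i).+1, i) = 'C((2 * i).+1, i.+1).
    by rewrite -bin_sub; [congr 'C(_, _) | ]; lia.
  by rewrite [in LHS]binS; lia.
rewrite /ballot !addn0 addn1 central mulnS add2n !binS !natrM !natrD; ring.
Qed.

Hypothesis pcharK : [pchar K] =i pred0.

Lemma natrS_neq0 (n : nat) : n.+1%:R != 0 :> K.
Proof. by rewrite ((pcharf0P K).1 pcharK). Qed.

Lemma catalan_ballot (m : nat) : catalan K m = ballot m 0.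
Proof.
have e1 := natr_bin_diag (2 * m) m; have e2 := natr_bin_down (2 * m) m.+1.
have e : m.+1%:R * ballot m 0 = 'C(2 * m, m)%:R.
  apply: (mulfI (natrS_neq0 (2 * m))); rewrite /ballot addn0.
  by rewrite mulrCA mulrBr e2 e1; ring.
by rewrite /catalan -e mulrC mulKf ?natrS_neq0.
Qed.

(** As T is symmetric, a row shift can be moved from [i] to [j] until [i] is 0; row 0 of B is the
    first unit vector, which leaves [ballot j 0]. *)
Lemma sum_ballot (N i j : nat) : (i < N)%N ->
  \sum_(0 <= k < N) ballot i k * ballot j k = catalan K (i + j).
Proof.
(* The last two terms come from cutting T off after index [M]; they vanish once [a < M]. *)
have telescope M a b : \sum_(0 <= k < M.+1) ballot a.+1 k * ballot b k =
    \sum_(0 <= k < M.+1) ballot a k * ballot b.+1 k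
    + ballot a M.+1 * ballot b M - ballot a M * ballot b M.+1.
  elim: M => [|M IHM]; first by rewrite !big_nat1 !ballot_rec0; ring.
  rewrite [LHS]big_nat_recr // [in RHS]big_nat_recr //= IHM !ballot_recS; ring.
case: N => // N; elim: i j => [|i IHi] j lt_iN.
- rewrite big_nat_recl //= big1 ?addr0 => [|k _]; last first.
    by rewrite ballot_small ?mul0r.
  by rewrite ballot_diag mul1r catalan_ballot.
- rewrite telescope (ballot_small i N) // (ballot_small i N.+1) ?ltnS 1?ltnW //.
  by rewrite IHi 1?ltnW // !mul0r addr0 subr0 addSnnS.
Qed.

(** This and [natr_bin_ballotS] reduce two adjacent ballot numbers to the one binomial in [F], with
    its lower index reflected by [binz_sym]. *)
Lemma natr_bin_ballot (a b : nat) :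
  (2 * a).+2%:R * (2 * a).+1%:R * ballot a b
  = (2 * b%:R + 1) * (a + b).+2%:R * 'C((2 * a).+2, (a + b).+2)%:R.
Proof.
set n := (2 * a)%N; set m := (a + b)%N.
rewrite /ballot -/n -/m mulrBr -!mulrA natr_bin_diag (natr_bin_down n m.+1).
rewrite ![n.+2%:R * (_ * _)]mulrCA !natr_bin_diag /n /m; ring.
Qed.

Lemma natr_bin_ballotS (a b : nat) :
  (2 * a).+2%:R * (2 * a).+1%:R * ballot a b.+1
  = (2 * b%:R + 3) * (a%:R - b%:R) * 'C((2 * a).+2, (a + b).+2)%:R.
Proof.
set n := (2 * a)%N; set m := (a + b)%N.
rewrite /ballot addnS -/n -/m mulrBr -!mulrA natr_bin_diag.
rewrite (natr_bin_down n m.+2).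
rewrite ![n.+2%:R * (_ * _)]mulrCA !(natr_bin_down n.+1) /n /m; ring.
Qed.

Lemma binz_sym (a b : nat) :
  binz (2 * a.+1) (a.+1%:Z - b.+1%:Z) = 'C((2 * a).+2, (a + b).+2).
Proof.
have [le_ba|lt_ab] := leqP b a.
  have -> : a.+1%:Z - b.+1%:Z = (a - b)%N%:Z by lia.
  rewrite /= mulnS add2n -bin_sub; last by lia.
  by congr 'C(_, _); lia.
rewrite bin_small; last by lia.
by case E: (_ - _) => [m|m] //; lia.
Qed.

Lemma F_ballot (k i : nat) :
  F x k.+1 i.+1 = ballot i k * g x k.+1 + x * ballot i k.+1 * g x k.
Proof.
(* Absorbing the factor x shifts [r] by one; the weight [r / (2k+2-r)] gives both sums the same
   binomials and kills the new term at [r = 0]. *)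
have -> : x * ballot i k.+1 * g x k = ballot i k.+1 *
    \sum_(0 <= r < k.+2) r%:R / (2 * k.+1%:R - r%:R)
       * 'C(2 * k.+1 - r, r)%:R * x ^+ r.
  rewrite big_nat_recl // !mul0r add0r /g -mulrA mulrCA; congr (_ * _).
  rewrite mulr_sumr; apply: eq_big_nat => r /andP[_ lt_rk].
  have d_neq0 : 2 * k.+1%:R - r.+1%:R != 0 :> K.
    have -> : 2 * k.+1%:R - r.+1%:R = (2 * k - r).+1%:R :> K.
      rewrite -natrM -natrB; last by lia.
      by congr _%:R; lia.
    exact: natrS_neq0.
  have e : (2 * k.+1%:R - r.+1%:R) * 'C(2 * k - r, r)%:R
         = r.+1%:R * 'C(2 * k.+1 - r.+1, r.+1)%:R :> K.
    have -> : (2 * k.+1 - r.+1 = (2 * k - r).+1)%N by lia.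
    rewrite -natr_bin_diag; congr (_ * _).
    rewrite -natrM -natrB; last by lia.
    by congr _%:R; lia.
  apply: (mulfI d_neq0); rewrite mulrCA (mulrA _ 'C(_, _)%:R) e exprS.
  by field; rewrite !nat1r.
rewrite /F /g !mulr_sumr -big_split /=; apply: eq_big_nat => r /andP[_ lt_rk].
have d_neq0 : 2 * k.+1%:R - r%:R != 0 :> K.
  have -> : 2 * k.+1%:R - r%:R = (2 * k + 1 - r).+1%:R :> K.
    rewrite -natrM -natrB; last by lia.
    by congr _%:R; lia.
  exact: natrS_neq0.
have i_neq0 : (2 * i).+2%:R * (2 * i).+1%:R != 0 :> K.
  by rewrite mulf_neq0 ?natrS_neq0.
rewrite -[ballot i k](mulKf i_neq0) natr_bin_ballot.
rewrite -[ballot i k.+1](mulKf i_neq0) natr_bin_ballotS binz_sym /Fcoef.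
field.
by rewrite !nat1r d_neq0 -natrM nat1r -natrD add2n !natrS_neq0.
Qed.

Lemma F_diag (k : nat) : F x k.+1 k.+1 = g x k.+1.
Proof.
by rewrite F_ballot ballot_diag ballot_small // mulr0 !mul0r addr0 mul1r.
Qed.

Lemma F_eq0 (k i : nat) : (i < k)%N -> F x k.+1 i.+1 = 0.
Proof.
move=> lt_ik; rewrite F_ballot (ballot_small i k) // (ballot_small i k.+1).
  by rewrite mulr0 !mul0r addr0.
exact: ltnW.
Qed.

Hypothesis g_neq0 : forall k : nat, g x k != 0.

(** Column [N] of B D' involves column [N.+1] of B, so a partial sum overshoots by two terms. Both
    contain [ballot i N.+1], which is 0 for [i <= N]. *)
Lemma sum_LU (N i j : nat) :
  \sum_(0 <= k < N.+1)
     F x k.+1 i.+1 / g x k.+1 * (F x k.+1 j.+1 / g x k)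
  = \sum_(0 <= k < N.+1) ballot i k * (ballot j k + x * ballot j.+1 k)
    + x * ballot i N.+1 * ballot j N
    + x ^+ 2 * ballot i N.+1 * ballot j N.+1 * (g x N / g x N.+1).
Proof.
elim: N => [|N IHN].
  rewrite !big_nat1 !F_ballot ballot_rec0 g0.
  have := g_neq0 1; rewrite g1 => g1_neq0; field.
  by rewrite g1_neq0 oner_neq0.
rewrite [LHS]big_nat_recr // [in RHS]big_nat_recr //= IHN !F_ballot.
rewrite ballot_recS.
(* By [g_rec], the new pivot g(N+2)/g(N+1) plus the carried x^2 g(N)/g(N+1) is 1 + 2x, the diagonal
   entry of 1 + x T. *)
have := g_neq0 N.+2; have := g_neq0 N.+1; rewrite g_rec => gS_neq0 gSS_neq0.
field.
by rewrite gS_neq0 gSS_neq0.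
Qed.

Lemma LU_catalan (n : nat) : L_mx x n *m U_mx x n = catalan_mx x n.
Proof.
apply/matrixP => i j; rewrite !mxE.
under eq_bigr => k _ do rewrite !mxE subn1 /=.
case: n i j => [[]|n] // i j.
rewrite -(big_mkord xpredT
  (fun k => F x k.+1 i.+1 / g x k.+1 * (F x k.+1 j.+1 / g x k))).
rewrite sum_LU (ballot_small i) // !(mulr0, mul0r) !addr0.
under eq_bigr => k _ do rewrite mulrDr mulrCA.
rewrite big_split /= -mulr_sumr !sum_ballot //.
by rewrite !addSn !addnS !subSS !subn0.
Qed.

End LUDecomposition.

Lemma pchar_fraction_rat : [pchar {fraction {poly rat}}] =i pred0.
Proof.
apply/pcharf0P => n; rewrite -(rmorph_nat (@tofrac {poly rat})) tofrac_eq0.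
by rewrite -polyC_natr polyC_eq0 Num.Theory.pnatr_eq0.
Qed.

(** The underlying polynomial has constant coefficient 1. *)
Lemma g_indet_neq0 (k : nat) : g indet k != 0.
Proof.
pose p : {poly rat} := \sum_(0 <= r < k.+1) 'C(2 * k - r, r)%:R * 'X ^+ r.
have -> : g indet k = tofrac p.
  rewrite rmorph_sum; apply: eq_bigr => r _.
  by rewrite rmorphM rmorphXn rmorph_nat.
rewrite tofrac_eq0; apply/eqP => /polyP/(_ 0); apply/eqP.
rewrite /p big_nat_recl // bin0 expr0 mul1r coefD coef1 coef_sum coef0.
by rewrite big1 ?addr0 ?oner_neq0 // => r _; rewrite coefMXn.
Qed.

Theorem theorem1 (n : nat) (n_ge1 : (1 <= n)%N) :
  (forall k : nat, (1 <= k)%N -> F indet k k = g indet k) /\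
  [/\ is_trig_mx (L_mx indet n),
      forall i : 'I_n, L_mx indet n i i = 1,
      is_trig_mx (U_mx indet n)^T
    & L_mx indet n *m U_mx indet n = catalan_mx indet n].
Proof.
have pchar0 := pchar_fraction_rat.
split; first by case=> // k _; apply: F_diag.
split.
- by apply/is_trig_mxP => i j lt_ij; rewrite mxE F_eq0 ?mul0r.
- by move=> i; rewrite mxE F_diag ?divff ?g_indet_neq0.
- by apply/is_trig_mxP => i j lt_ij; rewrite !mxE F_eq0 ?mul0r.
- exact: LU_catalan pchar0 g_indet_neq0 n.
Qed.
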